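(* Let $n\ge 1$, let $b\colon B\to\mathbb{C}^n$ be the real blow-up of $\mathbb{R}^n$ in $\mathbb{C}^n$, and let $\Sigma=b^{-1}(\mathbb{R}^n)$. The involutive structure on $B\setminus\Sigma$ obtained by pulling back, via the diffeomorphism $b\colon B\setminus\Sigma\to\mathbb{C}^n\setminus\mathbb{R}^n$, the complex structure of $\mathbb{C}^n\setminus\mathbb{R}^n$ extends smoothly across $\Sigma$ to determine an involutive structure on all of $B$. That is, there is a smooth complex subbundle $\mathcal{V}\subset\mathbb{C}TB$ with $[\mathcal{V},\mathcal{V}]\subset\mathcal{V}$ whose restriction to $B\setminus\Sigma$ is the bundle of $(0,1)$ vectors of the complex structure pulled back by $b$.
   Context: Involutive structure: an involutive structure on a smooth manifold $M$ is a smooth complex subbundle $\mathcal{V}$ of the complexified tangent bundle $\mathbb{C}TM$ such that $[\mathcal{V},\mathcal{V}]\subset\mathcal{V}$ (the bracket of two smooth sections is a section). A complex structure is regarded as an involutive structure by taking $\mathcal{V}=T^{0,1}$, the bundle of $(0,1)$ vectors. Real blow-up: if $N$ is a smooth submanifold of a smooth manifold $M$, the real blow-up $B$ of $N$ in $M$ is the smooth manifold, with smooth blow-down map $b\colon B\to M$, obtained by replacing each point $p\in N$ by the real projectivized normal space $\mathbb{P}(T_pM/T_pN)$. The set $\Sigma=b^{-1}(N)$ is a hypersurface in $B$ and $b\colon B\setminus\Sigma\to M\setminus N$ is a diffeomorphism. For $N=\mathbb{R}^n\subset M=\mathbb{C}^n$, concretely $B=\{(\zeta,\ell)\in\mathbb{C}^n\times\mathbb{RP}^{n-1}:\operatorname{Im}\zeta\in\ell\}$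 with $b(\zeta,\ell)=\zeta$. Here $B$ is a smooth real $2n$-manifold covered by $n$ coordinate charts, one for each standard basis direction of $\mathbb{R}^n$. The chart for the first basis direction has coordinates $(z,s,t)\in\mathbb{C}\times\mathbb{R}^{n-1}\times\mathbb{R}^{n-1}$, in which $b(z,s,t)=(z,s+zt)\in\mathbb{C}\times\mathbb{C}^{n-1}\cong\mathbb{C}^n$ and $\Sigma=\{\operatorname{Im}z=0\}$ (the point $\ell$ being the line spanned by $(1,t)$); the other charts are obtained by permuting the coordinates. *)

(* Defs.v *)
From HB Require Import structures.
From mathcomp Require Import all_boot all_order all_algebra.
From mathcomp Require Import all_classical all_reals all_analysis.
From mathcomp Require Import complex.

Set Implicit Arguments.
Unset Strict Implicit.
Unset Printing Implicit Defensive.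

Import Order.TTheory GRing.Theory Num.Theory.
Import numFieldNormedType.Exports.

Local Open Scope classical_set_scope.
Local Open Scope ring_scope.

(* [U] is meant to be open; the values of [f] outside [U] are irrelevant. *)
Fixpoint Ck (R : realType) (V W : normedModType R) (k : nat) (U : set V)
    (f : V -> W) : Prop :=
  match k with
  | 0 => forall x, U x -> {for x, continuous f}
  | k'.+1 => (forall x, U x -> differentiable f x) /\
             (forall v, Ck k' U ('D_v f))
  end.

Definition smooth_on (R : realType) (V W : normedModType R) (U : set V)
    (f : V -> W) : Prop := forall k, Ck k U f.

Section smooth_calculus.
Context {R : realType} {V : normedModType R}.
Implicit Types (U : set V).

Lemma near_eq_differentiable (W : normedModType R) (f g : V -> W) x :
  {near x, f =1 g} -> differentiable f x -> differentiable g x.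
Proof.
move=> fg /diff_locallyP[cdf fE].
have gE : g \o shift x = cst (g x) + 'd f x +o_ 0 id.
  apply/eqaddoP => eps eps0; have /eqaddoP/(_ eps eps0) := fE.
  have : \forall y \near (0 : V), f (y + x) = g (y + x).
    have := fg; rewrite (near_shift 0 x) /=.
    by apply: filterS => y /=; rewrite subr0.
  apply: filterS2 => y fgy.
  suff -> : (g \o shift x - (cst (g x) + 'd f x)) y =
            (f \o shift x - (cst (f x) + 'd f x)) y by [].
  have fgx : f x = g x by exact: (nbhs_singleton fg).
  by rewrite -[LHS]/(g (y + x) - (g x + 'd f x y)) -fgy -fgx.
apply/diff_locallyP; rewrite (diff_unique cdf gE); split => //.
Qed.


Lemma Ck_ext (W : normedModType R) k U (f g : V -> W) :
  open U -> (forall x, U x -> f x = g x) -> Ck k U f -> Ck k U g.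
Proof.
move=> oU; elim: k f g => [|k IH] f g fg /=.
- move=> cf x Ux; have nfg : {near x, f =1 g}.
    by near=> y; apply: fg; near: y; exact: open_nbhs_nbhs.
  have := cf x Ux; rewrite /prop_for /continuous_at -(fg x Ux).
  by apply: cvg_trans; exact: near_eq_cvg.
- have nfg x : U x -> {near x, f =1 g}.
    by move=> Ux; near=> y; apply: fg; near: y; exact: open_nbhs_nbhs.
  move=> [df Df]; split=> [x Ux|v].
    exact: near_eq_differentiable (nfg x Ux) (df x Ux).
  by apply: IH (Df v) => x Ux; apply: near_eq_derive; exact: nfg.
Unshelve. all: by end_near. Qed.

Lemma CkW (W : normedModType R) k U (f : V -> W) : Ck k.+1 U f -> Ck k U f.
Proof.
elim: k f => [|k IH] f [df Df].
  by move=> x Ux; exact: differentiable_continuous (df x Ux).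
by split=> // v; apply: IH.
Qed.

Lemma Ck_cst (W : normedModType R) k U (a : W) : Ck k U (cst a : V -> W).
Proof.
elim: k a => [|k IH] a; first by move=> x _; exact: cst_continuous.
split=> [x _|v]; first exact: differentiable_cst.
suff -> : 'D_v (cst a) = cst (0 : W) by exact: IH.
by apply/funext => x; rewrite derive_cst.
Qed.

Lemma CkD (W : normedModType R) k U (f g : V -> W) : open U ->
  Ck k U f -> Ck k U g -> Ck k U (f + g).
Proof.
move=> oU; elim: k f g => [|k IH] f g.
  by move=> cf cg x Ux; apply: continuousD; [exact: cf|exact: cg].
move=> [df Df] [dg Dg]; split=> [x Ux|v].
  exact: differentiableD (df x Ux) (dg x Ux).
apply: Ck_ext oU _ (IH _ _ (Df v) (Dg v)) => x Ux.
by rewrite deriveD //; exact: diff_derivable (_ x Ux).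
Qed.

Lemma CkM k U (f g : V -> R) : open U ->
  Ck k U f -> Ck k U g -> Ck k U (f * g).
Proof.
move=> oU; elim: k f g => [|k IH] f g.
  by move=> cf cg x Ux; apply: continuousM; [exact: cf|exact: cg].
move=> Cf Cg; have [df Df] := Cf; have [dg Dg] := Cg; split=> [x Ux|v].
  exact: differentiableM (df x Ux) (dg x Ux).
apply: Ck_ext oU _ (CkD oU (IH _ _ (CkW Cf) (Dg v)) (IH _ _ (CkW Cg) (Df v))).
by move=> x Ux; rewrite deriveM //; exact: diff_derivable (_ x Ux).
Qed.

Lemma CkZl (W : normedModType R) k U (f : V -> R) (w : W) : open U ->
  Ck k U f -> Ck k U (fun x => f x *: w).
Proof.
move=> oU; elim: k f => [|k IH] f.
  by move=> cf x Ux; apply: cvgZr_tmp; exact: cf.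
move=> [df Df]; split=> [x Ux|v]; first exact: differentiableZl (df x Ux).
apply: Ck_ext oU _ (IH _ (Df v)) => x Ux.
have dfx := df x Ux.
by rewrite !deriveE ?diffZl //; exact: differentiableZl.
Qed.

Lemma CkN k U (f : V -> R) : open U -> Ck k U f -> Ck k U (- f).
Proof.
move=> oU Cf; have C1 := CkM oU (Ck_cst (W := R) k U (-1 : R)) Cf.
apply: Ck_ext oU _ C1 => x _.
by rewrite -[LHS]/(-1 * f x) mulN1r.
Qed.

Lemma CkV k U (f : V -> R) : open U -> (forall x, U x -> f x != 0) ->
  Ck k U f -> Ck k U (fun x => (f x)^-1).
Proof.
move=> oU f0; elim: k => [|k IH].
  by move=> cf x Ux; apply: continuousV; [exact: f0|exact: cf].
move=> Cf; have [df Df] := Cf; split=> [x Ux|v].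
  exact: differentiableV (df x Ux) (f0 x Ux).
have CV := IH (CkW Cf).
apply: Ck_ext oU _ (CkN oU (CkM oU (CkM oU CV CV) (Df v))) => x Ux.
rewrite (deriveV (f0 x Ux)); last exact: diff_derivable (df x Ux).
rewrite -[LHS]/(- ((f x)^-1 * (f x)^-1 * 'D_v f x)).
by rewrite -mulNr -expr2 exprVn.
Qed.

End smooth_calculus.

Lemma Ck_coord (R : realType) m k (U : set 'rV[R]_m) (c : 'I_m) :
  Ck k U (fun x : 'rV[R]_m => x 0 c).
Proof.
case: k => [x _|k]; first exact: coord_continuous.
split=> [x _|v]; first exact: differentiable_coord.
suff -> : 'D_v (fun x : 'rV[R]_m => x 0 c) = cst (v 0 c) by exact: Ck_cst.
apply/funext => x.
have d : derivable (@id ('rV[R]_m)) x v by exact: derivable_id.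
have := derive_mx d.
by rewrite derive_id => /matrixP/(_ 0 c); rewrite mxE /= => ->.
Qed.

Lemma Ck_row (R : realType) (V : normedModType R) m k (U : set V)
    (f : V -> 'rV[R]_m) : open U ->
  (forall c, Ck k U (fun x => f x 0 c)) -> Ck k U f.
Proof.
move=> oU Cf.
suff : Ck k U (\sum_(c < m) (fun x => f x 0 c *: (delta_mx 0 c : 'rV[R]_m))).
  move=> S; apply: Ck_ext oU _ S => x _; rewrite fct_sumE.
  by rewrite -row_sum_delta.
elim/big_ind : _ => [|g h|c _].
- exact: Ck_cst.
- exact: CkD.
- exact: CkZl.
Qed.


Record smooth_atlas (R : realType) (m : nat) (M : Type) := SmoothAtlas {
  chart_idx : Type;
  chart_dom : chart_idx -> set M;
  chart : chart_idx -> M -> 'rV[R]_m;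
  chart_inv : chart_idx -> 'rV[R]_m -> M;
  chart_cover : forall p, exists i, chart_dom i p;
  chartK : forall i p, chart_dom i p -> chart_inv i (chart i p) = p;
  chart_overlap_open : forall i j,
    open (chart i @` (chart_dom i `&` chart_dom j));
  chart_transition_smooth : forall i j,
    smooth_on (chart i @` (chart_dom i `&` chart_dom j))
              (chart j \o chart_inv i)
}.

Section complexification.
Context {R : realType}.

Definition re_mx {p q} (A : 'M[R[i]]_(p, q)) : 'M[R]_(p, q) :=
  map_mx (@complex.Re R) A.

Definition im_mx {p q} (A : 'M[R[i]]_(p, q)) : 'M[R]_(p, q) :=
  map_mx (@complex.Im R) A.

Definition cplx_mx {p q} (A : 'M[R]_(p, q)) : 'M[R[i]]_(p, q) :=
  map_mx (real_complex R) A.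

Definition csmooth_on {m p q} (U : set 'rV[R]_m)
    (F : 'rV[R]_m -> 'M[R[i]]_(p, q)) : Prop :=
  smooth_on U (re_mx \o F) /\ smooth_on U (im_mx \o F).

(* Row convention, as for ['J]: [v *m cjac F x] is the derivative of [F] at [x]
   along the complex vector [v]. *)
Definition cjac {m q} (F : 'rV[R]_m -> 'rV[R[i]]_q) (x : 'rV[R]_m) :
    'M[R[i]]_(m, q) :=
  cplx_mx ('J (re_mx \o F) x) + 'i%C *: cplx_mx ('J (im_mx \o F) x).

Definition lie_bracket {m} (X Y : 'rV[R]_m -> 'rV[R[i]]_m) (x : 'rV[R]_m) :
    'rV[R[i]]_m :=
  X x *m cjac Y x - Y x *m cjac X x.

End complexification.

Section involutive_structures.
Context {R : realType} {m : nat} {M : Type} (A : smooth_atlas R m M).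

(* A family of subsets of the complexified tangent spaces: [V i p v] says that
   the vector with components [v] in the coordinate frame of the chart [i]
   belongs to the fibre at [p].  It is only meaningful for [p] in the domain of
   [i]. *)
Definition tangent_family := chart_idx A -> M -> set 'rV[R[i]]_m.

Implicit Types V : tangent_family.

Definition chart_independent V : Prop :=
  forall i j p, chart_dom i p -> chart_dom j p -> forall v,
    V i p v <->
    V j p (v *m cplx_mx ('J (chart j \o chart_inv i) (chart i p))).

Definition smooth_subbundle (r : nat) V : Prop :=
  chart_independent V /\
  forall i p, @chart_dom _ _ _ A i p ->
    exists (O : set 'rV[R]_m) (F : 'rV[R]_m -> 'M[R[i]]_(r, m)),
      [/\ open O, O (chart i p), O `<=` chart i @` chart_dom i,
          csmooth_on O F &
          forall x, O x -> row_free (F x) /\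
            V i (chart_inv i x) = [set v | (v <= F x)%MS]].

Definition section_on V i (O : set 'rV[R]_m) (X : 'rV[R]_m -> 'rV[R[i]]_m) :=
  forall x, O x -> V i (chart_inv i x) (X x).

Definition bracket_closed V : Prop :=
  forall i (O : set 'rV[R]_m) (X Y : 'rV[R]_m -> 'rV[R[i]]_m),
    open O -> O `<=` chart i @` chart_dom i ->
    csmooth_on O X -> csmooth_on O Y ->
    section_on V i O X -> section_on V i O Y ->
    section_on V i O (lie_bracket X Y).

Definition involutive_structure V : Prop :=
  (exists r, smooth_subbundle r V) /\ bracket_closed V.

(* The preimage, under the complexified differential of [f], of the same
   subspace [T] of each tangent space of R^q. *)
Definition pullback_family {q} (f : M -> 'rV[R]_q) (T : set 'rV[R[i]]_q) :
    tangent_family :=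
  fun i p => [set v | T (v *m cplx_mx ('J (f \o chart_inv i) (chart i p)))].

End involutive_structures.

Section complex_space.
Context (R : realType) (n : nat).

(* C^n as R^(2n), with coordinates (Re zeta, Im zeta). *)
Definition real_coords (zeta : 'rV[R[i]]_n) : 'rV[R]_(n + n) :=
  row_mx (re_mx zeta) (im_mx zeta).

(* J maps d/dx_k to d/dy_k and d/dy_k to - d/dx_k. *)
Definition Jmx : 'M[R]_(n + n) := block_mx 0 1%:M (- 1%:M) 0.

Definition T01 : set 'rV[R[i]]_(n + n) :=
  [set w | w *m cplx_mx Jmx = - 'i%C *: w].

End complex_space.

Section real_blowup.
Context (R : realType) (n : nat).

Record real_blowup := RealBlowup {
  bl_down : 'rV[R[i]]_n;
  bl_line : {vspace 'rV[R]_n};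
  bl_line_dim : \dim bl_line = 1%N;
  bl_line_im : im_mx bl_down \in bl_line
}.

(* the preimage of R^n under the blow-down map *)
Definition bl_hypersurface : set real_blowup :=
  [set p | im_mx (bl_down p) = 0].

(* The chart for the basis direction [j] has coordinates [row_mx u v], where
   [u 0 j] and [v 0 j] are the real and imaginary parts of z, and [u 0 k] and
   [v 0 k] are, for [k != j], the components of s and t. *)
Definition bl_tau (j : 'I_n) (x : 'rV[R]_(n + n)) : 'rV[R]_n :=
  \row_k (if k == j then 1 else rsubmx x 0 k).

Definition bl_zeta (j : 'I_n) (x : 'rV[R]_(n + n)) : 'rV[R[i]]_n :=
  let z := (lsubmx x 0 j +i* rsubmx x 0 j)%C in
  \row_k (if k == j then z
          else (lsubmx x 0 k)%:C%C + z * (rsubmx x 0 k)%:C%C).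

Lemma bl_tau_neq0 j x : bl_tau j x != 0.
Proof.
by apply/rV0Pn; exists j; rewrite mxE eqxx oner_neq0.
Qed.

Lemma bl_tau_dim j x : \dim <[bl_tau j x]>%VS = 1%N.
Proof. by rewrite dim_vline bl_tau_neq0. Qed.

Lemma im_bl_zeta j x : im_mx (bl_zeta j x) = rsubmx x 0 j *: bl_tau j x.
Proof.
apply/rowP => k; rewrite !mxE; case: eqP => _ /=; first by rewrite mulr1.
by rewrite mulr0 !add0r.
Qed.

Lemma re_bl_zeta j x : re_mx (bl_zeta j x) = \row_k
  (if k == j then lsubmx x 0 j
   else lsubmx x 0 k + lsubmx x 0 j * rsubmx x 0 k).
Proof.
apply/rowP => k; rewrite !mxE; case: eqP => _ //=.
by rewrite mulr0 subr0.
Qed.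

Lemma bl_zeta_line j x : im_mx (bl_zeta j x) \in <[bl_tau j x]>%VS.
Proof. by rewrite im_bl_zeta memvZ ?memv_line. Qed.

Definition bl_param (j : 'I_n) (x : 'rV[R]_(n + n)) : real_blowup :=
  RealBlowup (bl_tau_dim j x) (bl_zeta_line j x).

Definition bl_dom (j : 'I_n) : set real_blowup :=
  [set p | exists2 w, w \in bl_line p & w 0 j != 0].

(* for [p] in [bl_dom j], the vector of the line with [j]-th component 1 *)
Definition bl_dir (j : 'I_n) (p : real_blowup) : 'rV[R]_n :=
  (vpick (bl_line p) 0 j)^-1 *: vpick (bl_line p).

Definition bl_chart (j : 'I_n) (p : real_blowup) : 'rV[R]_(n + n) :=
  let x := re_mx (bl_down p) in
  let y := im_mx (bl_down p) in
  row_mx (\row_k (if k == j then x 0 j else x 0 k - x 0 j * bl_dir j p 0 k))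
         (\row_k (if k == j then y 0 j else bl_dir j p 0 k)).

Lemma real_blowupP (p q : real_blowup) :
  bl_down p = bl_down q -> bl_line p = bl_line q -> p = q.
Proof.
case: p q => [z l d e] [z' l' d' e'] /= zz' ll'; subst z' l'.
by rewrite (eq_irrelevance d d') (eq_irrelevance e e').
Qed.

Lemma bl_line_pick (p : real_blowup) : bl_line p = <[vpick (bl_line p)]>%VS.
Proof.
apply/eqP; rewrite eq_sym eqEdim -memvE memv_pick /= bl_line_dim dim_vline.
by rewrite vpick0 -dimv_eq0 bl_line_dim.
Qed.

Lemma bl_dirE j p w : w \in bl_line p -> w 0 j != 0 ->
  bl_dir j p = (w 0 j)^-1 *: w.
Proof.
rewrite bl_line_pick => /vlineP[c ->]; rewrite mxE mulf_eq0 negb_or.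
move=> /andP[c0 w0]; rewrite /bl_dir scalerA invfM mulrAC mulVf //.
by rewrite mul1r.
Qed.

Lemma bl_dir_in j p : bl_dir j p \in bl_line p.
Proof. by rewrite memvZ ?memv_pick. Qed.

Lemma bl_dirj j p : bl_dom j p -> bl_dir j p 0 j = 1.
Proof. by move=> [w wp w0]; rewrite (bl_dirE wp w0) mxE mulVf. Qed.

Lemma bl_line_dir j p : bl_dom j p -> bl_line p = <[bl_dir j p]>%VS.
Proof.
move=> pj; apply/eqP; rewrite eq_sym eqEdim -memvE bl_dir_in /= bl_line_dim.
rewrite dim_vline lt0b; apply/rV0Pn; exists j.
by rewrite bl_dirj ?oner_neq0.
Qed.

Lemma im_bl_down j p : bl_dom j p ->
  im_mx (bl_down p) = im_mx (bl_down p) 0 j *: bl_dir j p.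
Proof.
move=> pj; have := bl_line_im p; rewrite {1}(bl_line_dir pj) => /vlineP[c E].
by rewrite E mxE bl_dirj // mulr1.
Qed.

Lemma bl_cover p : exists j, bl_dom j p.
Proof.
have : vpick (bl_line p) != 0 by rewrite vpick0 -dimv_eq0 bl_line_dim.
by move=> /rV0Pn[j pj]; exists j, (vpick (bl_line p)); rewrite ?memv_pick.
Qed.

Lemma bl_tau_chart j p : bl_dom j p -> bl_tau j (bl_chart j p) = bl_dir j p.
Proof.
move=> pj; apply/rowP => k; rewrite mxE /bl_chart row_mxKr mxE.
by case: (eqVneq k j) => [->|//]; rewrite bl_dirj.
Qed.

Lemma bl_chartK j p : bl_dom j p -> bl_param j (bl_chart j p) = p.
Proof.
move=> pj; apply: real_blowupP; last first.
  by rewrite /= bl_tau_chart // -bl_line_dir.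
suff [re im] : re_mx (bl_zeta j (bl_chart j p)) = re_mx (bl_down p) /\
               im_mx (bl_zeta j (bl_chart j p)) = im_mx (bl_down p).
  apply/rowP => k; apply/eqP; rewrite eq_complex; apply/andP; split; apply/eqP.
    by have := congr1 (fun A : 'rV_n => A 0 k) re; rewrite /re_mx mxE => ->; rewrite mxE.
  by have := congr1 (fun A : 'rV_n => A 0 k) im; rewrite /im_mx mxE => ->; rewrite mxE.
split.
  rewrite re_bl_zeta; apply/rowP => k; rewrite /bl_chart row_mxKl row_mxKr.
  rewrite [LHS]mxE !mxE eqxx; case: (eqVneq k j) => [->//|_].
  by rewrite subrK.
rewrite im_bl_zeta bl_tau_chart // [RHS](im_bl_down pj).
by rewrite /bl_chart row_mxKr !mxE eqxx.
Qed.

Lemma bl_dir_param i j x : bl_tau i x 0 j != 0 ->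
  bl_dir j (bl_param i x) = (bl_tau i x 0 j)^-1 *: bl_tau i x.
Proof. by move=> x0; apply: bl_dirE => //=; exact: memv_line. Qed.

Lemma bl_dom_param i j x : bl_dom j (bl_param i x) <-> bl_tau i x 0 j != 0.
Proof.
split=> [[w /vlineP[c ->]]|x0]; last first.
  by exists (bl_tau i x) => //=; exact: memv_line.
by rewrite mxE mulf_eq0 negb_or => /andP[].
Qed.

Lemma bl_paramK j x : bl_chart j (bl_param j x) = x.
Proof.
have xj : bl_tau j x 0 j = 1 by rewrite mxE eqxx.
rewrite /bl_chart bl_dir_param xj ?oner_neq0 // invr1 scale1r.
rewrite -[RHS]hsubmxK; congr row_mx; apply/rowP => k; rewrite mxE.
  rewrite /= re_bl_zeta; case: (eqVneq k j) => [->|/negPf kj].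
    by rewrite mxE eqxx.
  rewrite [X in X - _]mxE kj [X in _ - X * _]mxE eqxx.
  by rewrite [X in _ - _ * X]mxE kj addrK.
rewrite /= im_bl_zeta; case: (eqVneq k j) => [->|/negPf kj].
  by rewrite mxE xj mulr1.
by rewrite mxE kj.
Qed.

Lemma bl_overlap i j :
  bl_chart i @` (bl_dom i `&` bl_dom j) = [set x | bl_tau i x 0 j != 0].
Proof.
apply/seteqP; split=> [_ [p [pi pj] <-] /=|x /= x0].
  by apply/bl_dom_param; rewrite bl_chartK.
exists (bl_param i x); last exact: bl_paramK.
split; apply/bl_dom_param => //.
by rewrite mxE eqxx oner_neq0.
Qed.

Lemma Ck_lsubmx k U (c : 'I_n) :
  Ck k U (fun x : 'rV[R]_(n + n) => lsubmx x 0 c).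
Proof.
by under eq_fun do rewrite mxE; exact: Ck_coord.
Qed.

Lemma Ck_rsubmx k U (c : 'I_n) :
  Ck k U (fun x : 'rV[R]_(n + n) => rsubmx x 0 c).
Proof.
by under eq_fun do rewrite mxE; exact: Ck_coord.
Qed.

Lemma Ck_bl_tau k U i (c : 'I_n) : Ck k U (fun x => bl_tau i x 0 c).
Proof.
under eq_fun do rewrite mxE; case: eqP => _; last exact: Ck_rsubmx.
exact: Ck_cst.
Qed.

Lemma Ck_re_bl_zeta k U i (c : 'I_n) : open U ->
  Ck k U (fun x => re_mx (bl_zeta i x) 0 c).
Proof.
move=> oU; under eq_fun do rewrite re_bl_zeta mxE.
case: eqP => _; first exact: Ck_lsubmx.
apply: (CkD oU); first exact: Ck_lsubmx.
by apply: (CkM oU); [exact: Ck_lsubmx|exact: Ck_rsubmx].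
Qed.

Lemma Ck_im_bl_zeta k U i (c : 'I_n) : open U ->
  Ck k U (fun x => im_mx (bl_zeta i x) 0 c).
Proof.
move=> oU; under eq_fun do rewrite im_bl_zeta mxE.
by apply: (CkM oU); [exact: Ck_rsubmx|exact: Ck_bl_tau].
Qed.

Lemma bl_overlap_open i j : open (bl_chart i @` (bl_dom i `&` bl_dom j)).
Proof.
rewrite bl_overlap.
have C0 := Ck_bl_tau 0 setT i j.
apply: (@open_comp _ _ (fun x => bl_tau i x 0 j) [set y | y != 0]).
  by move=> x _; exact: C0.
exact: open_neq.
Qed.

Lemma bl_transition_smooth i j :
  smooth_on (bl_chart i @` (bl_dom i `&` bl_dom j)) (bl_chart j \o bl_param i).
Proof.
move=> k; have oU := @bl_overlap_open i j.
have Cdir c : Ck k (bl_chart i @` (bl_dom i `&` bl_dom j))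
    (fun x => bl_dir j (bl_param i x) 0 c).
  have CV : Ck k (bl_chart i @` (bl_dom i `&` bl_dom j))
      (fun x => (bl_tau i x 0 j)^-1).
    by apply: (CkV oU); [by rewrite bl_overlap|exact: Ck_bl_tau].
  apply: Ck_ext oU _ (CkM oU CV (Ck_bl_tau k _ i c)) => x.
  by rewrite bl_overlap => x0; rewrite bl_dir_param // mxE.
apply: (Ck_row oU) => c; rewrite -[c](splitK c).
case: (fintype.split c) => {}c /=; under eq_fun do
  rewrite /bl_chart ?(row_mxEl, row_mxEr) mxE.
- case: eqP => _; first exact: Ck_re_bl_zeta.
  apply: (CkD oU); first exact: Ck_re_bl_zeta.
  by apply: (CkN oU); apply: (CkM oU) => //; exact: Ck_re_bl_zeta.
- by case: eqP => _; first exact: Ck_im_bl_zeta.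
Qed.

Definition bl_atlas : smooth_atlas R (n + n) real_blowup :=
  SmoothAtlas bl_cover bl_chartK bl_overlap_open bl_transition_smooth.

End real_blowup.

(* Main.v *)
Require Import Defs.
From HB Require Import structures.
From mathcomp Require Import all_boot all_order all_algebra.
From mathcomp Require Import all_classical all_reals all_analysis.
From mathcomp Require Import complex.
From mathcomp Require Import ring.

Set Implicit Arguments.
Unset Strict Implicit.
Unset Printing Implicit Defensive.

Import Order.TTheory GRing.Theory Num.Theory.
Import numFieldNormedType.Exports.

Local Open Scope classical_set_scope.
Local Open Scope ring_scope.

(** Off [bl_hypersurface] the required structure is the common kernel of the
    pulled-back one-forms [d zeta_k].  The point is that these n forms stay
    linearly independent on the hypersurface, so that their common kernel over
    the whole blow-up is already the extension.

    In the chart of the direction [j], with coordinates [u] and [v], every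
    component reads [zeta_k = u_k + c_k v_k] ([bl_zeta_slope]), where
    [c_j = i] and [c_k = zeta_j] for [k != j] ([bl_slope]).  Hence
    [d zeta_j = du_j + i dv_j], and for [k != j]
    [d zeta_k = (du_k + c_k dv_k) + v_k d zeta_j].  This change of basis is
    unipotent, at real points as well as elsewhere, so the kernel of the
    [d zeta_k] is that of the forms [du_k + c_k dv_k] ([bl_01P]).  It has the
    global smooth frame [d/dv_k - c_k d/du_k] in the chart ([bl_frameP]), hence
    constant rank n.

    Independence of the chart is the chain rule
    ([pullback_chart_independent]), since the kernel is defined by a map on the
    blow-up itself.  For involutivity ([lie_bracket_bl_01]), the slopes [c_k]
    are constant or equal to [zeta_j], so a section [X] kills them; by the
    Leibniz rule, differentiating the equation [Y(u_k) = - c_k Y(v_k)] along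
    [X] thus gives an equation of the same form, and [[X, Y]] satisfies it
    too. *)

(** * Jacobian matrices *)

Section jacobian_rows.
Context {R : realType}.

Lemma row_jacobian m q (f : 'rV[R]_m -> 'rV[R]_q) x a :
  differentiable f x -> row a ('J f x) = 'D_(delta_mx 0 a) f x.
Proof. by move=> df; rewrite deriveEjacobian // rowE. Qed.

Lemma jacobianE m q (f : 'rV[R]_m -> 'rV[R]_q) x a c : differentiable f x ->
  'J f x a c = 'D_(delta_mx 0 a) (fun y => f y 0 c) x.
Proof.
move=> df; have := row_jacobian a df.
rewrite derive_mx; last exact: diff_derivable.
by move=> /rowP/(_ c); rewrite !mxE.
Qed.

Lemma near_eq_jacobian m q (f g : 'rV[R]_m -> 'rV[R]_q) x :
  {near x, f =1 g} -> differentiable f x -> 'J f x = 'J g x.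
Proof.
move=> fg df; have dg := near_eq_differentiable fg df.
apply/row_matrixP => a; apply: (etrans (row_jacobian a df)).
by apply: etrans (esym (row_jacobian a dg)); exact: near_eq_derive.
Qed.

Lemma jacobian_comp m q r (f : 'rV[R]_m -> 'rV[R]_q)
    (g : 'rV[R]_q -> 'rV[R]_r) x :
  differentiable f x -> differentiable g (f x) ->
  'J (g \o f) x = 'J f x *m 'J g (f x).
Proof.
move=> df dg; apply/row_matrixP => a; rewrite row_mul !rowE /jacobian.
by rewrite !mul_rV_lin1 diff_comp.
Qed.

Lemma differentiable_component m q (f : 'rV[R]_m -> 'rV[R]_q) x c :
  differentiable f x -> differentiable (fun y => f y 0 c) x.
Proof.
move=> df; apply: (differentiable_comp (g := fun y : 'rV_q => y 0 c) df).
exact: differentiable_coord.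
Qed.

Lemma differentiable_row (V : normedModType R) q (f : V -> 'rV[R]_q) x :
  (forall c, differentiable (fun y => f y 0 c) x) -> differentiable f x.
Proof.
move=> df.
suff -> : f = \sum_(c < q) (fun y => f y 0 c *: (delta_mx 0 c : 'rV[R]_q)).
  by apply: differentiable_sum => c; exact: differentiableZl.
by apply/funext => y; rewrite fct_sumE -row_sum_delta.
Qed.

Lemma differentiable_row_mx (V : normedModType R) q r (f : V -> 'rV[R]_q)
    (g : V -> 'rV[R]_r) x :
  (forall c, differentiable (fun y => f y 0 c) x) ->
  (forall c, differentiable (fun y => g y 0 c) x) ->
  differentiable (fun y => row_mx (f y) (g y)) x.
Proof.
move=> df dg; apply: differentiable_row => c; rewrite -[c](splitK c).
by case: (fintype.split c) => {}c /=; under eq_fun do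
  rewrite ?(row_mxEl, row_mxEr).
Qed.

Lemma jacobian_row_mx m q r (f : 'rV[R]_m -> 'rV[R]_q)
    (g : 'rV[R]_m -> 'rV[R]_r) x : differentiable f x -> differentiable g x ->
  'J (fun y => row_mx (f y) (g y)) x = row_mx ('J f x) ('J g x).
Proof.
move=> df dg; apply/matrixP => a c.
have dfg : differentiable (fun y => row_mx (f y) (g y)) x.
  by apply: differentiable_row_mx => b; exact: differentiable_component.
rewrite (jacobianE _ _ dfg) -[c](splitK c).
case: (fintype.split c) => {}c /=.
- rewrite row_mxEl (jacobianE _ _ df).
  by under eq_fun do rewrite row_mxEl.
- rewrite row_mxEr (jacobianE _ _ dg).
  by under eq_fun do rewrite row_mxEr.
Qed.

End jacobian_rows.

Lemma cplx_mxM (R : realType) p q r (A : 'M[R]_(p, q)) (B : 'M[R]_(q, r)) :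
  cplx_mx (A *m B) = cplx_mx A *m cplx_mx B.
Proof. exact: map_mxM. Qed.

(** By the chain rule, the differentials of [f] read in two charts differ by the
    Jacobian of the transition map, which is also how tangent vectors change. *)
Lemma pullback_chart_independent (R : realType) m M (A : smooth_atlas R m M)
    q (f : M -> 'rV[R]_q) (T : set 'rV[R[i]]_q) :
  (forall i p, chart_dom i p ->
    differentiable (f \o chart_inv (s := A) i) (chart i p)) ->
  chart_independent (pullback_family (A := A) f T).
Proof.
move=> df i j p pi pj v; rewrite /pullback_family /=.
set x := chart i p; set U := chart i @` (chart_dom i `&` chart_dom j).
have Ux : U x by exists p.
have xp : chart_inv i x = p by exact: chartK.
have dt : differentiable (chart j \o chart_inv i) x.
  by have [+ _] := @chart_transition_smooth _ _ _ A i j 1%N; exact.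
have E : {near x, (f \o chart_inv j) \o (chart j \o chart_inv i)
                    =1 f \o chart_inv i}.
  have : \forall y \near x, U y.
    by apply: open_nbhs_nbhs; split => //; exact: chart_overlap_open.
  apply: filterS => _ [p' [p'i p'j] <-] /=.
  by rewrite (chartK p'i) (chartK p'j).
have dfj : differentiable (f \o chart_inv j) ((chart j \o chart_inv i) x).
  by rewrite /= xp; exact: df.
rewrite -(near_eq_jacobian E); last exact: differentiable_comp.
by rewrite jacobian_comp // cplx_mxM mulmxA /= xp.
Qed.

(** * Derivatives of complex-valued functions along complex vectors *)

Section complex_derivative.
Context {R : realType} {m : nat}.
Implicit Types (f g : 'rV[R]_m -> R[i]) (v : 'rV[R[i]]_m) (x : 'rV[R]_m).

Definition cdifferentiable f x : Prop :=
  differentiable (fun y => complex.Re (f y)) x /\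
  differentiable (fun y => complex.Im (f y)) x.

Definition cpartial (a : 'I_m) f x : R[i] :=
  ('D_(delta_mx 0 a) (fun y => complex.Re (f y)) x +i*
   'D_(delta_mx 0 a) (fun y => complex.Im (f y)) x)%C.

(** The complex-linear extension to complex [v] of the directional derivative:
    no holomorphy of [f] is involved. *)
Definition cderive v f x : R[i] := \sum_a v 0 a * cpartial a f x.

Lemma near_eq_cderive v f g x : {near x, f =1 g} ->
  cderive v f x = cderive v g x.
Proof.
move=> fg; apply: eq_bigr => a _; congr (_ * (_ +i* _)%C);
  by apply: near_eq_derive; apply: filterS fg => y ->.
Qed.

Lemma ReM (a b : R[i]) : complex.Re (a * b) =
  complex.Re a * complex.Re b - complex.Im a * complex.Im b.
Proof. by case: a b => [? ?] [? ?]. Qed.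

Lemma ImM (a b : R[i]) : complex.Im (a * b) =
  complex.Re a * complex.Im b + complex.Im a * complex.Re b.
Proof. by case: a b => [? ?] [? ?]. Qed.

Lemma cdifferentiableM f g x : cdifferentiable f x -> cdifferentiable g x ->
  cdifferentiable (fun y => f y * g y) x.
Proof.
move=> [rf jf] [rg jg]; split.
- under eq_fun do rewrite ReM.
  by apply: differentiableB; apply: differentiableM.
- under eq_fun do rewrite ImM.
  by apply: differentiableD; apply: differentiableM.
Qed.

Lemma cderiveD v f g x : cdifferentiable f x -> cdifferentiable g x ->
  cderive v (fun y => f y + g y) x = cderive v f x + cderive v g x.
Proof.
move=> [rf jf] [rg jg]; rewrite /cderive -big_split; apply: eq_bigr => a _ /=.
rewrite -mulrDr; congr (_ * _); rewrite /cpartial.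
have -> : (fun y => complex.Re (f y + g y)) =
    (fun y => complex.Re (f y)) + (fun y => complex.Re (g y)).
  by apply/funext => y; rewrite raddfD.
have -> : (fun y => complex.Im (f y + g y)) =
    (fun y => complex.Im (f y)) + (fun y => complex.Im (g y)).
  by apply/funext => y; rewrite raddfD.
by rewrite !deriveD //; exact: diff_derivable.
Qed.

Lemma cderiveM v f g x : cdifferentiable f x -> cdifferentiable g x ->
  cderive v (fun y => f y * g y) x = f x * cderive v g x + g x * cderive v f x.
Proof.
move=> [rf jf] [rg jg]; rewrite /cderive !big_distrr -big_split.
apply: eq_bigr => a _ /=.
suff -> : cpartial a (fun y => f y * g y) x =
          f x * cpartial a g x + g x * cpartial a f x by ring.
have d h : differentiable h x -> derivable h x (delta_mx 0 a : 'rV[R]_m).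
  by move=> ?; exact: diff_derivable.
have reE : (fun y => complex.Re (f y * g y)) =
    (fun y => complex.Re (f y)) * (fun y => complex.Re (g y)) -
    (fun y => complex.Im (f y)) * (fun y => complex.Im (g y)).
  by apply/funext => y; rewrite ReM.
have imE : (fun y => complex.Im (f y * g y)) =
    (fun y => complex.Re (f y)) * (fun y => complex.Im (g y)) +
    (fun y => complex.Im (f y)) * (fun y => complex.Re (g y)).
  by apply/funext => y; rewrite ImM.
rewrite /cpartial reE imE deriveB ?deriveD ?deriveM;
  try by apply: d => //; exact: differentiableM.
case: (f x) (g x) => [? ?] [? ?]; apply/eqP; rewrite eq_complex /=.
by rewrite /GRing.scale /=; apply/andP; split; apply/eqP; ring.
Qed.

Lemma cdifferentiable_cst (a : R[i]) x : cdifferentiable (cst a) x.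
Proof. by split; exact: differentiable_cst. Qed.

Lemma cderive_cst v (a : R[i]) x : cderive v (cst a) x = 0.
Proof.
rewrite /cderive big1 // => b _; rewrite /cpartial !derive_cst.
by rewrite mulr0.
Qed.

Lemma cdifferentiable_coord (c : 'I_m) x :
  cdifferentiable (fun y => (y 0 c)%:C%C) x.
Proof. by split; [exact: differentiable_coord | exact: differentiable_cst]. Qed.

Lemma cderive_coord v (c : 'I_m) x :
  cderive v (fun y => (y 0 c)%:C%C) x = v 0 c.
Proof.
have E a : cpartial a (fun y => (y 0 c)%:C%C) x = (a == c)%:R.
  have did : derivable (@id 'rV[R]_m) x (delta_mx 0 a) by exact: derivable_id.
  have := derive_mx did.
  rewrite derive_id => /rowP/(_ c); rewrite !mxE eqxx /= => E.
  by rewrite /cpartial derive_cst /= -E eq_sym; case: eqP.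
rewrite /cderive (bigD1 c) //= E eqxx mulr1 big1 ?addr0 // => a /negPf ac.
by rewrite E ac mulr0.
Qed.

Lemma mul_cjacE q v (F : 'rV[R]_m -> 'rV[R[i]]_q) x c :
  differentiable (re_mx \o F) x -> differentiable (im_mx \o F) x ->
  (v *m cjac F x) 0 c = cderive v (fun y => F y 0 c) x.
Proof.
move=> dr di; rewrite mxE; apply: eq_bigr => a _; congr (_ * _).
have E (A B : 'M[R]_(m, q)) :
    (cplx_mx A + 'i%C *: cplx_mx B) a c = (A a c +i* B a c)%C.
  rewrite !mxE; apply/eqP; rewrite eq_complex /=.
  by apply/andP; split; apply/eqP; ring.
apply: (etrans (E _ _)); congr (_ +i* _)%C.
- by rewrite (jacobianE a c dr) /=; under eq_fun do rewrite mxE.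
- by rewrite (jacobianE a c di) /=; under eq_fun do rewrite mxE.
Qed.

Lemma csmooth_cdifferentiable q (O : set 'rV[R]_m)
    (F : 'rV[R]_m -> 'rV[R[i]]_q) x : csmooth_on O F -> O x ->
  [/\ differentiable (re_mx \o F) x, differentiable (im_mx \o F) x &
      forall c, cdifferentiable (fun y => F y 0 c) x].
Proof.
move=> [/(_ 1%N)[dr _] /(_ 1%N)[di _]] Ox; have {}dr := dr x Ox.
have {}di := di x Ox; split=> // c; split.
- have := differentiable_component c dr.
  by under eq_fun do rewrite mxE.
- have := differentiable_component c di.
  by under eq_fun do rewrite mxE.
Qed.

(** This is the usual formula [[X, Y](y_c) = X(Y(y_c)) - Y(X(y_c))]; it lets
    brackets be computed one component at a time by the Leibniz rule. *)
Lemma cderive_lie_bracket (O : set 'rV[R]_m) (X Y : 'rV[R]_m -> 'rV[R[i]]_m)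
    x c : csmooth_on O X -> csmooth_on O Y -> O x ->
  lie_bracket X Y x 0 c =
  cderive (X x) (fun y => Y y 0 c) x - cderive (Y x) (fun y => X y 0 c) x.
Proof.
move=> CX CY Ox; have [rX iX _] := csmooth_cdifferentiable CX Ox.
have [rY iY _] := csmooth_cdifferentiable CY Ox.
have E (u w : 'rV[R[i]]_m) : (u - w) 0 c = u 0 c - w 0 c by rewrite !mxE.
by apply: (etrans (E _ _)); congr (_ - _); exact: mul_cjacE.
Qed.

End complex_derivative.

(** * Smooth frames and (0,1) vectors *)

Lemma Ck_mx (R : realType) (V : normedModType R) p q k (U : set V)
    (f : V -> 'M[R]_(p, q)) : open U ->
  (forall a c, Ck k U (fun x => f x a c)) -> Ck k U f.
Proof.
move=> oU Cf.
suff : Ck k U (\sum_(a < p) \sum_(c < q)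
    (fun x => f x a c *: (delta_mx a c : 'M[R]_(p, q)))).
  move=> S; apply: Ck_ext oU _ S => x _; rewrite fct_sumE.
  under eq_bigr do rewrite fct_sumE.
  by rewrite -matrix_sum_delta.
elim/big_ind : _ => [|g h|a _]; [exact: Ck_cst|exact: CkD|].
elim/big_ind : _ => [|g h|c _]; [exact: Ck_cst|exact: CkD|].
exact: CkZl.
Qed.

(** [a + i b] is the vector of values of the forms [dx_k + i dy_k] on the
    vector with components [(a, b)]: the (0,1) vectors are those killed by the
    differentials of the holomorphic coordinates. *)
Lemma T01_row_mx (R : realType) n (a b : 'rV[R[i]]_n) :
  T01 (row_mx a b) <-> a + 'i%C *: b = 0.
Proof.
rewrite /T01 /=.
have -> : cplx_mx (@Jmx R n) = block_mx 0 1%:M (- 1%:M) 0.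
  by rewrite /cplx_mx /Jmx map_block_mx map_mxN !map_mx0 !map_mx1.
rewrite mul_row_block !mulmx0 !mulmx1 mulmxN mulmx1 add0r addr0 scale_row_mx.
have ii : 'i%C * 'i%C = -1 :> R[i] by rewrite -expr2 sqr_i.
split=> [/eq_row_mx[_ ->]|/eqP]; first by rewrite scaleNr addNr.
rewrite addr_eq0 => /eqP ->; congr row_mx.
  by rewrite scaleNr scalerN opprK scalerA ii scaleN1r.
by rewrite scaleNr.
Qed.

Lemma T01_real_coords (R : realType) m n (f : 'rV[R]_m -> 'rV[R[i]]_n) x
    (v : 'rV[R[i]]_m) :
  differentiable (re_mx \o f) x -> differentiable (im_mx \o f) x ->
  T01 (v *m cplx_mx ('J (@real_coords R n \o f) x)) <-> v *m cjac f x = 0.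
Proof.
move=> dr di; rewrite (jacobian_row_mx dr di).
rewrite [cplx_mx (row_mx _ _)]map_row_mx mul_mx_row.
by rewrite /cjac mulmxDr -scalemxAr; exact: T01_row_mx.
Qed.

(** * The structure on the blow-up *)

Section blowup_structure.
Context {R : realType} {n : nat}.
Implicit Types (j k : 'I_n) (x : 'rV[R]_(n + n)) (v : 'rV[R[i]]_(n + n)).

(** The coefficients [c_k].  Giving the direction [k = j] the constant slope
    [i] puts [zeta_j = u_j + i v_j] in the same form as the other components,
    so that one formula covers all the forms and the whole frame. *)
Definition bl_slope j k x : R[i] :=
  if k == j then 'i%C else bl_zeta j x 0 j.

Lemma bl_zeta_slope j k x : bl_zeta j x 0 k =
  (x 0 (lshift n k))%:C%C + bl_slope j k x * (x 0 (rshift n k))%:C%C.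
Proof.
rewrite /bl_slope !mxE; case: eqP => [->|_]; rewrite ?eqxx ?mxE //.
by apply/eqP; rewrite eq_complex /=; apply/andP; split; apply/eqP; ring.
Qed.

Lemma csmooth_bl_zeta j : csmooth_on setT (bl_zeta (R := R) j).
Proof.
split=> l; apply: (Ck_row openT) => c.
- exact: Ck_re_bl_zeta openT.
- exact: Ck_im_bl_zeta openT.
Qed.

Lemma cdifferentiable_bl_slope j k x : cdifferentiable (bl_slope j k) x.
Proof.
rewrite /bl_slope; case: eqP => _; first exact: cdifferentiable_cst.
by have [_ _] := csmooth_cdifferentiable (csmooth_bl_zeta j) (I : setT x).
Qed.

Lemma cderive_bl_zeta j k v x : cderive v (fun y => bl_zeta j y 0 k) x =
  v 0 (lshift n k) + bl_slope j k x * v 0 (rshift n k) +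
  (x 0 (rshift n k))%:C%C * cderive v (bl_slope j k) x.
Proof.
under eq_fun do rewrite bl_zeta_slope.
have dc c := cdifferentiable_coord c x.
have ds := cdifferentiable_bl_slope j k x.
rewrite cderiveD //; last exact: cdifferentiableM.
by rewrite cderiveM // !cderive_coord addrA.
Qed.

Definition bl_01 j x : set 'rV[R[i]]_(n + n) :=
  [set v | forall k, v 0 (lshift n k) = - (bl_slope j k x * v 0 (rshift n k))].

(** A non-constant slope is [zeta_j], whose derivative involves only the
    constant slope [c_j = i]; its vanishing is one of the equations of
    [bl_01]. *)
Lemma cderive_bl_slope j k v x : bl_01 j x v -> cderive v (bl_slope j k) x = 0.
Proof.
move=> vx; rewrite /bl_slope; case: eqP => _; first exact: cderive_cst.
rewrite cderive_bl_zeta vx addNr add0r /bl_slope eqxx.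
by rewrite [cderive _ _ _]cderive_cst mulr0.
Qed.

(** The unipotent change of basis between the forms [d zeta_k] and
    [du_k + c_k dv_k], valid also where [zeta_j] is real: the correction term
    [v_k d c_k] vanishes on the common kernel of either family. *)
Lemma bl_01P j x v :
  bl_01 j x v <-> forall k, cderive v (fun y => bl_zeta j y 0 k) x = 0.
Proof.
split=> [vx k|vz].
  by rewrite cderive_bl_zeta cderive_bl_slope // vx addNr mulr0 addr0.
have slope0 k : cderive v (bl_slope j k) x = 0.
  by rewrite /bl_slope; case: eqP => _; [exact: cderive_cst|exact: vz].
move=> k; have := vz k; rewrite cderive_bl_zeta slope0 mulr0 addr0.
by move=> /eqP; rewrite addr_eq0 => /eqP.
Qed.

(** Sections kill the slopes, so the Leibniz rule carries the defining equations
    through differentiation along a section. *)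
Lemma lie_bracket_bl_01 j (O : set 'rV[R]_(n + n))
    (X Y : 'rV[R]_(n + n) -> 'rV[R[i]]_(n + n)) :
  open O -> csmooth_on O X -> csmooth_on O Y ->
  (forall x, O x -> bl_01 j x (X x)) -> (forall x, O x -> bl_01 j x (Y x)) ->
  forall x, O x -> bl_01 j x (lie_bracket X Y x).
Proof.
move=> oO CX CY OX OY x Ox k; rewrite !(cderive_lie_bracket _ CX CY Ox).
have key (Z W : 'rV[R]_(n + n) -> 'rV[R[i]]_(n + n)) : csmooth_on O W ->
    (forall y, O y -> bl_01 j y (W y)) -> bl_01 j x (Z x) ->
    cderive (Z x) (fun y => W y 0 (lshift n k)) x =
    - (bl_slope j k x * cderive (Z x) (fun y => W y 0 (rshift n k)) x).
  move=> CW OW Zx; have [_ _ dW] := csmooth_cdifferentiable CW Ox.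
  have ds := cdifferentiable_bl_slope j k x.
  (* The equation of [W] holds on all of [O], hence near [x], and may be
     differentiated. *)
  transitivity (cderive (Z x)
      (fun y => (-1) * (bl_slope j k y * W y 0 (rshift n k))) x).
    apply: near_eq_cderive; near=> y; rewrite mulN1r; apply: OW.
    by near: y; exact: open_nbhs_nbhs.
  have dc : cdifferentiable (cst (-1 : R[i])) x by exact: cdifferentiable_cst.
  rewrite (cderiveM _ dc); last exact: cdifferentiableM.
  rewrite [cderive _ (cst _) x]cderive_cst cderiveM // cderive_bl_slope //=.
  by rewrite !mulr0 !addr0 mulN1r.
rewrite (key X Y) ?(key Y X) //; [|exact: OY|exact: OX].
by rewrite mulrBr opprB opprK addrC.
Unshelve. all: by end_near. Qed.

(** The k-th row is [d/dv_k - c_k d/du_k]. *)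
Definition bl_frame j x : 'M[R[i]]_(n, n + n) :=
  row_mx (- diag_mx (\row_k bl_slope j k x)) 1%:M.

Lemma bl_frame_free j x : row_free (bl_frame j x).
Proof.
apply/row_freeP; exists (col_mx 0 1%:M).
by rewrite mul_row_col mulmx0 mulmx1 add0r.
Qed.

Lemma bl_frameP j x : bl_01 j x = [set v | (v <= bl_frame j x)%MS].
Proof.
have mulE (w : 'rV[R[i]]_n) k :
    (w *m - diag_mx (\row_k bl_slope j k x)) 0 k = - (bl_slope j k x * w 0 k).
  by rewrite mulmxN mul_mx_diag !mxE mulrC.
apply/seteqP; split=> v /=.
- move=> vx; apply/submxP; exists (rsubmx v).
  rewrite mul_mx_row mulmx1 -[LHS]hsubmxK; congr row_mx.
  by apply/rowP => k; rewrite mulE mxE vx mxE.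
- move=> /submxP[w ->] k; rewrite mul_mx_row mulmx1 row_mxEl row_mxEr.
  exact: mulE.
Qed.

Lemma csmooth_bl_frame j : csmooth_on setT (bl_frame j).
Proof.
have slope l k : Ck l setT (fun x => complex.Re (bl_slope j k x)) /\
                 Ck l setT (fun x => complex.Im (bl_slope j k x)).
  rewrite /bl_slope; case: eqP => _; first by split; exact: Ck_cst.
  split.
  - have := @Ck_re_bl_zeta R n l setT j j openT.
    by under eq_fun do rewrite mxE.
  - have := @Ck_im_bl_zeta R n l setT j j openT.
    by under eq_fun do rewrite mxE.
split=> l; apply: (Ck_mx openT) => a c; rewrite -[c](splitK c);
  case: (fintype.split c) => {}c; rewrite /= /bl_frame;
  under eq_fun do rewrite mxE ?(row_mxEl, row_mxEr) !mxE;
  try exact: Ck_cst; case: eqP => _; rewrite /= ?mulr0n ?mulr1n.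
- under eq_fun do rewrite raddfN.
  by apply: (CkN openT); exact: (slope l _).1.
- under eq_fun do rewrite oppr0; exact: Ck_cst.
- under eq_fun do rewrite raddfN.
  by apply: (CkN openT); exact: (slope l _).2.
- under eq_fun do rewrite oppr0; exact: Ck_cst.
Qed.

(** The pullback is taken at every point, those of [bl_hypersurface] included:
    there the differential of the blow-down map is singular when [n > 1], but
    the preimage of the (0,1) vectors does not jump in dimension. *)
Definition bl_structure : tangent_family (bl_atlas R n) :=
  pullback_family (@real_coords R n \o @bl_down R n) (@T01 R n).

(** This is where the intrinsic definition meets the explicit equations: the
    former gives independence of the chart, the latter smoothness, constant
    rank and involutivity. *)
Lemma bl_structureE (j : 'I_n) (p : real_blowup R n) :
  bl_structure j p = bl_01 j (bl_chart j p).
Proof.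
have [dr di _] :=
  csmooth_cdifferentiable (csmooth_bl_zeta j) (I : setT (bl_chart j p)).
apply/seteqP; split=> v.
- move=> /(T01_real_coords v dr di) v0; apply/bl_01P => k.
  by rewrite -(mul_cjacE v k dr di) v0 mxE.
- move=> /bl_01P vz; apply/(T01_real_coords v dr di)/rowP => k.
  by rewrite (mul_cjacE v k dr di) vz mxE.
Qed.

Lemma bl_structure_param j x : bl_structure j (bl_param j x) = bl_01 j x.
Proof. by rewrite bl_structureE bl_paramK. Qed.

Lemma bl_chart_surj j : bl_chart j @` bl_dom (R := R) j = setT.
Proof.
rewrite -[bl_dom j]setIid bl_overlap; apply/seteqP; split=> // x _ /=.
by rewrite mxE eqxx oner_neq0.
Qed.

Lemma bl_structure_involutive : involutive_structure bl_structure.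
Proof.
split; first (exists n; split).
- apply: pullback_chart_independent => j p _.
  have [dr di _] :=
    csmooth_cdifferentiable (csmooth_bl_zeta j) (I : setT (bl_chart j p)).
  by apply: differentiable_row_mx => c; exact: differentiable_component.
- move=> j p _; exists setT, (bl_frame j); split=> //=.
  + exact: openT.
  + by rewrite bl_chart_surj.
  + exact: csmooth_bl_frame.
  + move=> x _; split; first exact: bl_frame_free.
    by rewrite -bl_frameP; exact: bl_structure_param.
- move=> j O X Y oO _ CX CY OX OY x Ox.
  rewrite /section_on /= in OX OY *; rewrite bl_structure_param.
  apply: lie_bracket_bl_01 oO CX CY _ _ x Ox => y Oy.
  + by rewrite -bl_structure_param; exact: OX.
  + by rewrite -bl_structure_param; exact: OY.
Qed.

End blowup_structure.

Theorem proposition2p2 (R : realType) (n : nat) (hn : (0 < n)%N) :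
  exists V : tangent_family (bl_atlas R n),
    involutive_structure V /\
    forall (i : chart_idx (bl_atlas R n)) (p : real_blowup R n),
      chart_dom i p -> ~ bl_hypersurface p ->
      V i p = pullback_family (@real_coords R n \o @bl_down R n)
                              (@T01 R n) i p.
Proof.
by exists (@bl_structure R n); split; first exact: bl_structure_involutive.
Qed.
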